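(* Let $(X,d)$ be a complete totally bounded CAT(0) space with modulus of total boundedness $\alpha:\mathbb{N}\to\mathbb{N}$ and let $f : X \to (-\infty,\infty]$ be a convex lower semicontinuous proper function whose set of minimizers $Argmin(f)$ is nonempty. Let $x\in X$ and $b>0$ be such that $d(x,p)\leq b$ for some minimizer $p$ of $f$. Assume that $(\gamma_n)_{n\in\mathbb{N}}$ is a sequence in $(0,\infty)$ such that $\sum_{n=0}^\infty \gamma_n = \infty$ with rate of divergence $\theta:\mathbb{N}\to\mathbb{N}$, and that $L:\mathbb{N}\to \mathbb{N}$ is a nondecreasing mapping satisfying $L(k)\geq \max_{0 \leq i \leq k} \gamma _i$ for all $k\in\mathbb{N}$. Let $(x_n)$ be the proximal point algorithm starting with $x$, i.e. $x_0:=x$ and $x_{n+1}:=J_{\gamma_n}x_n$ for all $n\in\mathbb{N}$. Let $\Psi_{b,\theta,L,\alpha},\Omega_{b,\theta,L,\alpha}:\mathbb{N}\times\mathbb{N}^{\mathbb{N}}\to\mathbb{N}$ be the functionals defined explicitly in the context. Then: (i) $\Psi_{b,\theta,L,\alpha}$ is a rate of metastability for $(x_n)$, i.e. for all $k\in\mathbb{N}$ and all $g:\mathbb{N}\to\mathbb{N}$ there exists $N\leq\Psi_{b,\theta,L,\alpha}(k,g)$ such that $d(x_i,x_j)\leq\frac1{k+1}$ for all $i,j\in[N,N+g(N)]$. (ii) For all $k \in \mathbb{N}$ and all $g: \mathbb{N} \to \mathbb{N}$ there exists $N\leq \Omega_{b,\theta,L,\alpha}(k,g)$ such that $$\forall i,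 j\in [N,N+g(N)]\ \left(d(x_i,x_j) \leq \frac1{k+1}\right) \quad\text{and}\quad \forall m\geq N\ \left(f(x_m) \leq \min(f) + \frac1{k+1}\right).$$
   Context: $\mathbb{N}=\{0,1,2,\ldots\}$, and for $m\leq n$ in $\mathbb{N}$, $[m,n]=\{m,m+1,\ldots,n\}$. For $h:\mathbb{N}\to\mathbb{N}$, $h^M:\mathbb{N}\to\mathbb{N}$ is defined by $h^M(n)=\max_{i\leq n}h(i)$. A geodesic in a metric space $(X,d)$ is a map $\gamma:[a,b]\to X$ with $d(\gamma(s),\gamma(t))=|s-t|$ for all $s,t\in[a,b]$. A geodesic space is a metric space in which every two points are joined by a geodesic. A CAT(0) space is a geodesic space $(X,d)$ such that for all $z\in X$, all geodesics $\gamma:[a,b]\to X$ and all $t\in[0,1]$, $$d^2(z,\gamma((1-t)a+tb)) \leq (1-t)d^2(z,\gamma(a)) + td^2(z,\gamma(b)) - t(1-t)d^2(\gamma(a),\gamma(b)).$$ CAT(0) spaces are uniquely geodesic, and convexity of functions is understood along geodesics. A function $f:X\to(-\infty,\infty]$ is proper if it is not identically $+\infty$. A modulus of total boundedness for $(X,d)$ is a function $\alpha:\mathbb{N}\to\mathbb{N}$ such that for any $k\in\mathbb{N}$ and any sequence $(y_n)$ in $X$ there exist $i,j\in[0,\alpha(k)]$ with $i<j$ and $d(y_i,y_j)\leq\frac1{k+1}$. For a convex, lower semicontinuous, proper $f$ on a complete CAT(0) space $X$ and $\gamma>0$, the resolvent (proximal mapping) of $f$ of order $\gamma$ is $$J_\gamma:X\to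 X,\quad J_\gamma(x)={\arg\min}_{y\in X}\left[f(y)+\frac1{2\gamma}d^2(x,y)\right];$$ it is known that this minimizer exists and is unique. A rate of divergence of $\sum_{n=0}^\infty\gamma_n=\infty$ is a mapping $\theta:\mathbb{N}\to\mathbb{N}$ with $\sum_{n=0}^{\theta(P)}\gamma_n\geq P$ for all $P\in\mathbb{N}$. Definitions of the functionals. Put $$\beta_{b, \theta}:\mathbb{N}\to\mathbb{N},\quad \beta_{b, \theta}(k)=\theta^M\left(\left\lceil \frac{b^2(k+1)}2 \right\rceil \right) +1.$$ For $g:\mathbb{N}\to\mathbb{N}$ put $$\chi_{g,L}^M:\mathbb{N}\times\mathbb{N} \to \mathbb{N}, \quad \chi_{g,L}^M(n,r)=\max_{i \leq n} \left[2L(i+g(i)-1)\,(g(i)(r+1)+1)^2-1\right],$$ where $i+g(i)-1$ is read as $0$ if $i=g(i)=0$. Define $(\Psi_0)_{b,\theta,L}:\mathbb{N}\times\mathbb{N}\times \mathbb{N}^\mathbb{N}\to \mathbb{N}$ by recursion: $$(\Psi_0)_{b,\theta,L}(0,k,g)=0,\qquad (\Psi_0)_{b,\theta,L}(n+1,k,g)=\beta_{b,\theta}\big(\chi_{g,L}^M((\Psi_0)_{b,\theta,L}(n,k,g),\,4k+3)\big).$$ Then $$\Psi_{b,\theta,L,\alpha}(k,g)=(\Psi_0)_{b,\theta,L}(\alpha(4k+3),k,g).$$ For $l\in\mathbb{N}$ and $g:\mathbb{N}\to\mathbb{N}$ let $g_l:\mathbb{N}\to\mathbb{N}$, $g_l(n)=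 g^M(n+l)+l$. Let $\Psi^*_{b,\theta,L,\alpha}(k,g)=\Psi_{b,\theta,L,\alpha^M}(k,g)$ (that is, $\Psi$ with $\alpha$ replaced by $\alpha^M$), and $$\Omega_{b,\theta,L,\alpha}(k,g)= \Psi^*_{b,\theta,L,\alpha}\big(k,g_{\beta_{b,\theta}(k)}\big) + \beta_{b,\theta}(k).$$ *)

(* Defs.v *)
From HB Require Import structures.
From mathcomp Require Import all_boot all_order all_algebra.
From mathcomp Require Import all_classical all_reals all_analysis.

Set Implicit Arguments.
Unset Strict Implicit.
Unset Printing Implicit Defensive.

Import Order.TTheory GRing.Theory Num.Theory.
Import numFieldNormedType.Exports.

Local Open Scope classical_set_scope.
Local Open Scope ring_scope.

#[short(type="completeMetricType")]
HB.structure Definition CompleteMetric (K : numDomainType) :=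
  { M of Metric K M & Complete M }.

(* A map on the segment [a, b] is represented by a function on the whole of R,
   whose values outside [a, b] are irrelevant. *)
Definition is_geodesic (R : realType) (X : metricType R)
    (a b : R) (c : R -> X) : Prop :=
  a <= b /\
  {in `[a, b] &, forall s t, mdist (c s) (c t) = `|s - t|}.

Definition geodesic_space (R : realType) (X : metricType R) : Prop :=
  forall y z : X, exists a b c,
    [/\ @is_geodesic R X a b c, c a = y & c b = z].

Definition CAT0 (R : realType) (X : metricType R) : Prop :=
  geodesic_space X /\
  forall (z : X) (a b : R) (c : R -> X) (t : R),
    is_geodesic a b c -> 0 <= t <= 1 ->
    mdist z (c ((1 - t) * a + t * b)) ^+ 2 <=
      (1 - t) * mdist z (c a) ^+ 2 + t * mdist z (c b) ^+ 2
      - t * (1 - t) * mdist (c a) (c b) ^+ 2.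

Definition totally_bounded (R : realType) (X : metricType R) : Prop :=
  forall e : R, 0 < e ->
    exists s : seq X, forall y : X, exists2 z, z \in s & mdist z y < e.

Definition modulus_of_total_boundedness (R : realType) (X : metricType R)
    (alpha : nat -> nat) : Prop :=
  forall (k : nat) (y : nat -> X),
    exists i j : nat, (i < j <= alpha k)%N /\ mdist (y i) (y j) <= k.+1%:R^-1.

(* In \bar R, 0 * +oo = 0, so the inequality is trivial for t = 0 and t = 1. *)
Definition geodesically_convex (R : realType) (X : metricType R)
    (f : X -> \bar R) : Prop :=
  forall (a b : R) (c : R -> X) (t : R),
    is_geodesic a b c -> 0 <= t <= 1 ->
    (f (c (((1 - t) * a + t * b)%R)) <=
       (1 - t)%:E * f (c a) + t%:E * f (c b))%E.

Definition proper_function (R : realType) (T : Type) (f : T -> \bar R) : Prop :=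
  (forall y, -oo < f y)%E /\ (exists y, f y != +oo)%E.

Definition Argmin (R : realType) (T : Type) (f : T -> \bar R) : set T :=
  [set p | forall y, (f p <= f y)%E].

Definition min_value (R : realType) (T : Type) (f : T -> \bar R) : \bar R :=
  ereal_inf (range f).

Lemma min_valueE (R : realType) (T : Type) (f : T -> \bar R) (p : T) :
  Argmin f p -> min_value f = f p.
Proof.
move=> fp; apply/eqP; rewrite eq_le; apply/andP; split.
  by apply: ereal_inf_lbound; exists p.
by apply: le_ereal_inf_tmp => _ [y _ <-]; exact: fp.
Qed.

(* For f convex, lsc and proper on a complete CAT(0) space, and gamma > 0, the
   minimizer exists and is unique, so xget returns it; its default value y is
   only reached outside this setting. *)
Definition resolvent (R : realType) (X : metricType R) (f : X -> \bar R)
    (gamma : R) (y : X) : X :=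
  xget y (Argmin (fun z => f z + ((2 * gamma)^-1 * mdist y z ^+ 2)%:E)%E).

Fixpoint proximal_point (R : realType) (X : metricType R) (f : X -> \bar R)
    (gamma : nat -> R) (x : X) (n : nat) : X :=
  if n is m.+1 then resolvent f (gamma m) (proximal_point f gamma x m) else x.

Definition rate_of_divergence (R : realType) (gamma : nat -> R)
    (theta : nat -> nat) : Prop :=
  forall P : nat, P%:R <= \sum_(0 <= n < (theta P).+1) gamma n.

Definition rate_of_metastability (R : realType) (X : metricType R)
    (u : nat -> X) (Phi : nat -> (nat -> nat) -> nat) : Prop :=
  forall (k : nat) (g : nat -> nat), exists2 N, (N <= Phi k g)%N &
    forall i j : nat, (N <= i <= N + g N)%N -> (N <= j <= N + g N)%N ->
      mdist (u i) (u j) <= k.+1%:R^-1.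

Definition maj (h : nat -> nat) (n : nat) : nat := (\max_(i < n.+1) h i)%N.

(* From f (x_n) - min f <= b ^ 2 / (2 * \sum_(i < n) gamma_i): the value from which
   on f (x_n) <= min f + 1 / (k + 1). *)
Definition min_rate (R : realType) (b : R) (theta : nat -> nat) (k : nat)
    : nat :=
  (maj theta `|Num.ceil (b ^+ 2 * k.+1%:R / 2)|%N + 1)%N.

(* Subtraction on nat is truncated: i + g i - 1 is 0 when i = g i = 0.  The
   outer subtraction is exact as soon as L is positive, which is the case when L
   bounds positive step sizes. *)
Definition chiM (g L : nat -> nat) (n r : nat) : nat :=
  (\max_(i < n.+1) (2 * L (i + g i - 1) * (g i * (r + 1) + 1) ^ 2 - 1))%N.

Fixpoint Psi0 (R : realType) (b : R) (theta L : nat -> nat)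
    (n k : nat) (g : nat -> nat) : nat :=
  if n is m.+1 then min_rate b theta (chiM g L (Psi0 b theta L m k g) (4 * k + 3))
  else 0%N.

Definition Psi (R : realType) (b : R) (theta L alpha : nat -> nat)
    (k : nat) (g : nat -> nat) : nat :=
  Psi0 b theta L (alpha (4 * k + 3)%N) k g.

Definition shift_counter (l : nat) (g : nat -> nat) (n : nat) : nat :=
  (maj g (n + l) + l)%N.

Definition Omega (R : realType) (b : R) (theta L alpha : nat -> nat)
    (k : nat) (g : nat -> nat) : nat :=
  (Psi b theta L (maj alpha) k (shift_counter (min_rate b theta k) g) +
   min_rate b theta k)%N.

(* Main.v *)
(* The minimality of z = J_gamma x, tested along the geodesic from z to y, gives
     2 gamma (f z - f y) <= d(x, y)^2 - d(x, z)^2 - d(z, y)^2.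
   Summed along the algorithm with y = p a minimizer, this yields
   f (x_n) - min f <= b^2 / (2 sum_(i < n) gamma_i), so that beta is a rate of
   convergence of the values.  With y = q an approximate minimizer, it bounds
   d(x_(n+l), q)^2 - d(x_n, q)^2 by 2 l L (f q - min f).  Among the iterates of
   index n_j = Psi_0(j, k, g), total boundedness provides i < j with x_(n_i) and
   q = x_(n_j) close to each other; q is so good an approximate minimizer that
   the iterates x_(n_i), ..., x_(n_i + g(n_i)) all stay close to it.
   The resolvent exists because minimizing sequences of its objective are
   Cauchy, by the CAT(0) inequality at midpoints. *)
Require Import Defs.
From HB Require Import structures.
From mathcomp Require Import all_boot all_order all_algebra.
From mathcomp Require Import all_classical all_reals all_analysis.
From mathcomp Require Import ring lra zify.

Set Implicit Arguments.
Unset Strict Implicit.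
Unset Printing Implicit Defensive.

Import Order.TTheory GRing.Theory Num.Theory.
Import numFieldNormedType.Exports.

Local Open Scope classical_set_scope.
Local Open Scope ring_scope.

(** * Resolvents in CAT(0) spaces *)

Lemma convex_geodesic_point (R : realType) (X : metricType R) (f : X -> \bar R)
    (y z : X) (r s t : R) :
  CAT0 X -> geodesically_convex f -> f y = r%:E -> f z = s%:E -> 0 <= t <= 1 ->
  exists w, (f w <= ((1 - t) * r + t * s)%:E)%E /\
    forall u, mdist u w ^+ 2 <= (1 - t) * mdist u y ^+ 2 + t * mdist u z ^+ 2
                                - t * (1 - t) * mdist y z ^+ 2.
Proof.
move=> [geoX cn] cvx fy fz t01; have [a [b [c [gc ca cb]]]] := geoX y z.
exists (c ((1 - t) * a + t * b)); split; last first.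
  by move=> u; rewrite -ca -cb; exact: cn.
by have := cvx _ _ _ _ gc t01; rewrite ca cb fy fz -!EFinM -EFinD.
Qed.

Lemma prox_objective_min (R : realType) (X : completeMetricType R)
    (f : X -> \bar R) (m c : R) (x : X) :
  CAT0 X -> proper_function f -> geodesically_convex f ->
  lower_semicontinuous f -> (forall y, m%:E <= f y)%E -> 0 < c ->
  Argmin (fun z => f z + (c * mdist x z ^+ 2)%:E)%E !=set0.
Proof.
move=> catX [_ [y0 fy0]] cvx lsc mf c0.
pose h z := (f z + (c * mdist x z ^+ 2)%:E)%E.
have mh y : (m%:E <= h y)%E.
  rewrite -[m%:E]adde0; apply: leeD => //.
  by rewrite lee_fin mulr_ge0 ?sqr_ge0 ?ltW.
pose E := ereal_inf (range h).
have Efin : E \is a fin_num.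
  rewrite fin_numElt; apply/andP; split.
    by apply: (lt_le_trans (ltNyr m)); apply: le_ereal_inf_tmp => _ [y _ <-].
  apply: (@le_lt_trans _ _ (h y0)); first by apply: ereal_inf_lbound; exists y0.
  by rewrite /h lte_add_pinfty ?ltry// lt_neqAle fy0 leey.
pose M := fine E.
have EM : E = M%:E by rewrite /M fineK.
have Mmin w r : (f w <= r%:E)%E -> M <= r + c * mdist x w ^+ 2.
  move=> fw; rewrite -lee_fin -EM EFinD; apply: (@le_trans _ _ (h w)).
    by apply: ereal_inf_lbound; exists w.
  by rewrite leeD2r.
have /choice[v vP] n : exists w : X * R, f w.1 = w.2%:E /\
    w.2 + c * mdist x w.1 ^+ 2 < M + n.+1%:R^-1.
  have n0 : 0 < n.+1%:R^-1 :> R by rewrite invr_gt0 ltr0n.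
  have [_ [w _ <-]] := lb_ereal_inf_adherent n0 Efin.
  rewrite -/E EM /h -EFinD; move: (mf w).
  case fw : (f w) => [r| |]//= _; rewrite -EFinD lte_fin => hw.
  by exists (w, r).
pose z n := (v n).1; pose r n := (v n).2.
have fz n : f (z n) = (r n)%:E by have [] := vP n.
have hz n : r n + c * mdist x (z n) ^+ 2 < M + n.+1%:R^-1 by have [] := vP n.
(* Comparing the infimum [M] with the objective at the midpoint of [z i] and [z j] bounds [c / 4]
   times their squared distance by the mean of the two excesses. *)
have zdist i j : c * mdist (z i) (z j) ^+ 2 <= 2 * (i.+1%:R^-1 + j.+1%:R^-1).
  have t01 : 0 <= (2^-1 : R) <= 1 by apply/andP; split; lra.
  have [w [fw dw]] := convex_geodesic_point catX cvx (fz i) (fz j) t01.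
  have := Mmin _ _ fw; have := hz i; have := hz j.
  have := ler_wpM2l (ltW c0) (dw x).
  set a := mdist x w ^+ 2; set a1 := mdist x (z i) ^+ 2.
  set a2 := mdist x (z j) ^+ 2; set a3 := mdist (z i) (z j) ^+ 2.
  set p := i.+1%:R^-1; set q := j.+1%:R^-1.
  lra.
have /cvg_ex[/= l zl] : cvg (z @ \oo).
  apply: cauchy_cvg; apply/cauchy_ballP => e e0; near_simpl.
  have d0 : 0 < c * e ^+ 2 / 4 by rewrite divr_gt0// mulr_gt0// exprn_gt0.
  near=> i j => /=; rewrite ballEmdist /=.
  have : i.+1%:R^-1 < c * e ^+ 2 / 4.
    by near: i; exact: (near_infty_natSinv_lt (PosNum d0)).
  have : j.+1%:R^-1 < c * e ^+ 2 / 4.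
    by near: j; exact: (near_infty_natSinv_lt (PosNum d0)).
  have := zdist i j; set p := i.+1%:R^-1; set q := j.+1%:R^-1 => zij pd qd.
  rewrite -(ltr_pXn2r (n := 2))// ?nnegrE ?mdist_ge0 ?ltW//.
  by rewrite -(ltr_pM2l c0); lra.
exists l => u; apply: (@le_trans _ _ M%:E); last first.
  by rewrite -EM; apply: ereal_inf_lbound; exists u.
rewrite leNgt; apply/negP => Mh.
set D := mdist x l in Mh.
(* Lower semicontinuity will keep [f (z n)] above [M - c * D ^+ 2] by the margin [e]. If [f l] is
   infinite, any margin works, here 1. *)
have [e e0 fl] : exists2 e, 0 < e & ((M - c * D ^+ 2 + e)%:E < f l)%E.
  move: Mh; case: (f l) (mf l) => [s| |]//= _.
    rewrite -EFinD lte_fin => Ms.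
    exists ((s + c * D ^+ 2 - M) / 2); first by lra.
    by rewrite lte_fin; lra.
  by move=> _; exists 1 => //; rewrite ltry.
have [V Vl fV] := lsc _ _ fl.
(* Within [eta] of [l], [c * (D ^+ 2 - d ^+ 2)] stays below [e / 2]; the other half of [e] absorbs
   [n.+1%:R^-1]. *)
pose eta := Num.min 1 (e / (2 * c * (2 * D + 1))).
have D0 : 0 <= D by exact: mdist_ge0.
have K0 : 0 < 2 * c * (2 * D + 1) by apply: mulr_gt0; lra.
have eta0 : 0 < eta by rewrite lt_min ltr01 divr_gt0.
have e20 : 0 < e / 2 by lra.
near \oo => n.
have fn : M - c * D ^+ 2 + e < r n.
  by rewrite -lte_fin -fz; apply: fV; near: n; exact: zl.
have nz : n.+1%:R^-1 < e / 2.
  by near: n; exact: (near_infty_natSinv_lt (PosNum e20)).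
have : mdist l (z n) < eta.
  by near: n; exact: metricType_numDomainType.cvgr_dist_lt.
rewrite lt_min ltr_pdivlMr// => /andP[dn1 dn2].
have := hz n; have := metric_triangle x (z n) l.
rewrite (metric_sym (z n) l) -/D.
set d := mdist x (z n) in fn *; set q := n.+1%:R^-1 in nz *.
have : 0 <= d by exact: mdist_ge0.
have : 0 <= mdist l (z n) by exact: mdist_ge0.
set a := mdist l (z n) in dn1 dn2 * => a0 d0 Dd hn.
have Da : D ^+ 2 - d ^+ 2 <= a * (2 * D + 1).
  have [dD|dD] := leP d D; last by nra.
  nra.
have := ler_wpM2l (ltW c0) Da.
nra.
Unshelve. all: by end_near. Qed.

Lemma resolventP (R : realType) (X : completeMetricType R) (f : X -> \bar R)
    (m g : R) (x : X) :
  CAT0 X -> proper_function f -> geodesically_convex f ->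
  lower_semicontinuous f -> (forall y, m%:E <= f y)%E -> 0 < g ->
  exists2 s, f (resolvent f g x) = s%:E &
    forall y r, f y = r%:E ->
      2 * g * (s - r) <=
        mdist x y ^+ 2 - mdist x (resolvent f g x) ^+ 2
        - mdist (resolvent f g x) y ^+ 2.
Proof.
move=> catX f_proper cvx lsc mf g0.
have c0 : 0 < (2 * g)^-1 by rewrite invr_gt0 mulr_gt0.
have [w Aw] := prox_objective_min x catX f_proper cvx lsc mf c0.
have := xgetPex x (ex_intro _ w Aw); rewrite -/(resolvent f g x).
set z := resolvent f g x => Az.
have [s fz] : exists s, f z = s%:E.
  have [_ [y0]] := f_proper; have := Az y0; move: (mf y0).
  case: (f y0) => [r| |]//= _; rewrite -EFinD.
  by case: (f z) (mf z) => [s| |]// _ _ _; exists s.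
exists s => // y r fy.
suff H : s - r <=
    (2 * g)^-1 * (mdist x y ^+ 2 - mdist x z ^+ 2 - mdist z y ^+ 2).
  have := ler_wpM2l (ltW (mulr_gt0 (ltr0Sn R 1) g0)) H.
  by rewrite mulrA mulfV ?mul1r// gt_eqF// mulr_gt0.
(* Testing at parameter t gives the claim with the extra term [t * (c * P)], hence up to any
   [e > 0]. *)
set c := (2 * g)^-1 in c0 Az *; apply/ler_addgt0Pr => e e0.
set P := mdist z y ^+ 2.
have P0 : 0 <= c * P by rewrite mulr_ge0 ?sqr_ge0 ?ltW.
have K0 : 0 < e + c * P + 1 by lra.
(* minimality of z is tested at the point of the geodesic [z, y] at parameter t,
   and t is then taken to 0 *)
pose t := e / (e + c * P + 1).
have t0 : 0 < t by rewrite divr_gt0.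
have t1 : t <= 1 by rewrite ler_pdivrMr//; lra.
have tP : t * (c * P) <= e.
  by rewrite /t mulrAC ler_pdivrMr// ler_wpM2l ?ltW//; lra.
have t01 : 0 <= t <= 1 by rewrite ltW.
have [w' [fw dw]] := convex_geodesic_point catX cvx fz fy t01.
have := Az w'; rewrite fz -EFinD.
move=> /le_trans/(_ (leeD2r _ fw)); rewrite -EFinD lee_fin.
have := ler_wpM2l (ltW c0) (dw x); rewrite -/P.
set A := mdist x w' ^+ 2; set B := mdist x z ^+ 2; set C := mdist x y ^+ 2.
move=> h1 h2; rewrite -(ler_pM2l t0).
have := ler_wpM2l (ltW t0) tP.
lra.
Qed.

(** * Monotonicity of the functionals *)

Lemma leq_maj (h : nat -> nat) (i n : nat) : (i <= n)%N -> (h i <= maj h n)%N.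
Proof.
rewrite -ltnS => lin.
exact: (@leq_bigmax _ (fun i : 'I_n.+1 => h i) (Ordinal lin)).
Qed.

Lemma maj_homo (h : nat -> nat) : {homo maj h : m n / (m <= n)%N}.
Proof.
move=> m n mn; apply/bigmax_leqP => i _.
by apply: leq_maj; rewrite (leq_trans _ mn)// -ltnS ltn_ord.
Qed.

(** Makes metastability available for [maj alpha], as [Omega] requires. *)
Lemma modulus_maj (R : realType) (X : metricType R) (alpha : nat -> nat) :
  modulus_of_total_boundedness X alpha ->
  modulus_of_total_boundedness X (maj alpha).
Proof.
move=> tb k y; have [i [j [/andP[ij ja] dij]]] := tb k y.
by exists i, j; rewrite ij (leq_trans ja)// leq_maj.
Qed.

Lemma min_rate_homo (R : realType) (b : R) (theta : nat -> nat) :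
  {homo min_rate b theta : m n / (m <= n)%N}.
Proof.
move=> m n mn; rewrite leq_add2r; apply: maj_homo.
have c0 k : 0 <= Num.ceil (b ^+ 2 * k.+1%:R / 2).
  by rewrite ceil_ge0 (lt_le_trans (ltrN10 R))// divr_ge0// mulr_ge0 ?sqr_ge0.
rewrite -lez_nat !gez0_abs//; apply: le_ceil.
by rewrite ler_pM2r ?invr_gt0// ler_wpM2l ?sqr_ge0// ler_nat.
Qed.

(** The successor on the right undoes the truncated final [- 1] of [chiM]. *)
Lemma leq_chiM (g L : nat -> nat) (i n r : nat) : (i <= n)%N ->
  (2 * L (i + g i - 1) * (g i * (r + 1) + 1) ^ 2 <= (chiM g L n r).+1)%N.
Proof.
rewrite -ltnS => lin; rewrite -[leqRHS]add1n -leq_subLR.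
exact: (@leq_bigmax _ (fun i : 'I_n.+1 =>
  2 * L (i + g i - 1) * (g i * (r + 1) + 1) ^ 2 - 1)%N (Ordinal lin)).
Qed.

Lemma chiM_homo (g L : nat -> nat) (r : nat) :
  {homo chiM g L ^~ r : m n / (m <= n)%N}.
Proof.
move=> m n mn; apply/bigmax_leqP => i _; rewrite leq_subLR add1n.
by apply: leq_chiM; rewrite (leq_trans _ mn)// -ltnS ltn_ord.
Qed.

Lemma Psi0_homo (R : realType) (b : R) (theta L g : nat -> nat) (k : nat) :
  {homo (fun n => Psi0 b theta L n k g) : m n / (m <= n)%N}.
Proof.
apply: homo_leq => [n|m n p|n]; [exact: leqnn|exact: leq_trans|].
elim: n => [//|n IH].
by apply: min_rate_homo; apply: chiM_homo.
Qed.

(** * Rates from a descent inequality *)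

(** Telescoping. It serves from [a = 0] with level 0 at a minimizer, and from a later index with the
    level of an approximate minimizer. *)
Lemma descent_sum (R : realType) (X : metricType R) (u : nat -> X)
    (gamma F : nat -> R) (c : R) (v : X) :
  (forall n, 2 * gamma n * (F n.+1 - c) <=
     mdist (u n) v ^+ 2 - mdist (u n.+1) v ^+ 2) ->
  forall a n, \sum_(a <= i < a + n) 2 * gamma i * (F i.+1 - c) <=
     mdist (u a) v ^+ 2 - mdist (u (a + n)%N) v ^+ 2.
Proof.
move=> desc a; elim=> [|n IH]; first by rewrite addn0 big_geq// subrr.
rewrite addnS big_nat_recr ?leq_addr//=.
by have := lerD IH (desc (a + n)%N); lra.
Qed.

(** Since [F] decreases, the telescoped sum dominates [2 * S * F n.+1], with [S] the sum of the step
    sizes, and [theta] makes [S] at least [b ^+ 2 * k.+1%:R / 2]. [F 0] is left free because [f] may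
    be infinite at the starting point. *)
Lemma le_min_rate (R : realType) (X : metricType R) (u : nat -> X)
    (gamma F : nat -> R) (b : R) (theta : nat -> nat) (p : X) :
  0 < b -> (forall n, 0 < gamma n) -> rate_of_divergence gamma theta ->
  (forall n, F n.+2 <= F n.+1) ->
  (forall n, 2 * gamma n * F n.+1 <=
     mdist (u n) p ^+ 2 - mdist (u n.+1) p ^+ 2) ->
  mdist (u 0%N) p <= b ->
  forall k n, (min_rate b theta k <= n)%N -> F n <= k.+1%:R^-1.
Proof.
move=> b0 gamma0 div F_decr desc up k [|n]; rewrite /min_rate addn1// ltnS.
set P := absz _ => lemn.
have [Fn|Fn] := lerP (F n.+1) 0; first by rewrite (le_trans Fn)// invr_ge0.
have F_homo i : (i <= n)%N -> F n.+1 <= F i.+1.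
  by move=> lin; apply: (@nonincreasing_seqP _ _ (fun i => F i.+1)).1.
pose S := \sum_(0 <= i < n.+1) gamma i.
have PS : P%:R <= S.
  rewrite (le_trans (div P))// /S.
  rewrite [leRHS](big_cat_nat (n := (theta P).+1))//=; last first.
    by rewrite ltnS (leq_trans _ lemn)// leq_maj.
  by rewrite lerDl sumr_ge0// => i _; rewrite ltW.
have bP : b ^+ 2 * k.+1%:R / 2 <= P%:R.
  rewrite (le_trans (ceil_ge _))// -[P%:R]/(P%:Z%:~R) ler_int /P gez0_abs//.
  by rewrite ceil_ge0 (lt_le_trans (ltrN10 R))// divr_ge0// mulr_ge0 ?sqr_ge0.
have SF : 2 * S * F n.+1 <= b ^+ 2.
  have desc0 i : 2 * gamma i * (F i.+1 - 0) <=
      mdist (u i) p ^+ 2 - mdist (u i.+1) p ^+ 2 by rewrite subr0.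
  have := descent_sum desc0 0 n.+1; rewrite add0n => sum_le.
  apply: (@le_trans _ _ (\sum_(0 <= i < n.+1) 2 * gamma i * (F i.+1 - 0))).
    rewrite /S mulr_sumr mulr_suml; apply: ler_sum_nat => i /andP[_ lin].
    by rewrite subr0 ler_wpM2l ?F_homo// mulr_ge0// ltW.
  rewrite (le_trans sum_le)// lerBlDr (@le_trans _ _ (b ^+ 2))//.
    by rewrite lerXn2r ?nnegrE ?mdist_ge0// ltW.
  by rewrite lerDl sqr_ge0.
rewrite -[_^-1]mul1r ler_pdivlMr ?ltr0n//.
have b20 : 0 < b ^+ 2 by rewrite exprn_gt0.
rewrite -(ler_pM2l b20) mulr1 (le_trans _ SF)//.
have := ler_wpM2r (ltW Fn) (le_trans bP PS); lra.
Qed.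

(** Explains the form of [chiM]: [l * (r + 1) ^ 2 <= (g * (r + 1)) ^ 2], as [g <= g ^ 2] on nat. *)
Lemma chiM_error (R : realFieldType) (l g r a c : nat) :
  (l <= g)%N -> (2 * a * (g * (r + 1) + 1) ^ 2 <= c.+1)%N ->
  2 * l%:R * a%:R * c.+1%:R^-1 <= r.+1%:R^-1 ^+ 2 :> R.
Proof.
move=> lg ac; rewrite ler_pdivrMr ?ltr0n// exprVn [leRHS]mulrC.
rewrite ler_pdivlMr ?exprn_gt0 ?ltr0n// -!natrM -natrX -natrM ler_nat.
rewrite -addn1; apply: leq_trans ac.
apply: (@leq_trans (2 * a * (g * (r + 1) ^ 2))).
  rewrite (_ : 2 * l * a * _ = 2 * a * (l * (r + 1) ^ 2))%N; last by ring.
  by rewrite !leq_mul.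
rewrite leq_mul2l; apply/orP; right.
apply: (@leq_trans ((g * (r + 1)) ^ 2)); last by rewrite leq_sqr leq_addr.
by rewrite expnMn leq_mul//; case: (g) => // g'; rewrite -mulnn leq_pmulr.
Qed.

Lemma descent_metastability (R : realType) (X : metricType R) (u : nat -> X)
    (gamma F : nat -> R) (b : R) (theta L alpha : nat -> nat) :
  (forall n, 0 < gamma n) ->
  (forall i k, (i <= k)%N -> gamma i <= (L k)%:R) ->
  (forall n, 0 <= F n.+1) ->
  (forall j n, 2 * gamma n * (F n.+1 - F j.+1) <=
     mdist (u n) (u j.+1) ^+ 2 - mdist (u n.+1) (u j.+1) ^+ 2) ->
  (forall k n, (min_rate b theta k <= n)%N -> F n <= k.+1%:R^-1) ->
  modulus_of_total_boundedness X alpha ->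
  rate_of_metastability u (Psi b theta L alpha).
Proof.
move=> gamma0 L_bound F0 desc F_rate tb k g.
(* Two iterates within [2 / (r + 1)] of a common point are within [4 / (r + 1) = 1 / (k + 1)] of
   each other. *)
set r := (4 * k + 3)%N.
pose nu j := Psi0 b theta L j k g.
have [i [j [/andP[ij ja] dij]]] := tb r (u \o nu).
case: j ij ja dij => // j ij ja dij.
exists (nu i); first by rewrite /Psi Psi0_homo// (leq_trans _ ja)// ltnW.
set n := nu i in dij *; set q := u (nu j.+1) in dij *.
(* The [+ 1] in [min_rate] makes this index positive, so [desc] applies at [q]. *)
have [q' nuq] : exists q', nu j.+1 = q'.+1.
  by rewrite /nu /= /min_rate addn1; eexists.
set chi := chiM g L (nu j) r.
have Fq : F (nu j.+1) <= chi.+1%:R^-1 by apply: F_rate.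
(* From [i <= j] follows [nu i <= nu j], so [n] is among the indices of the maximum defining
   [chi]. *)
have chi_ge : (2 * L (n + g n - 1) * (g n * (r + 1) + 1) ^ 2 <= chi.+1)%N.
  by apply: leq_chiM; exact: Psi0_homo.
(* The initial distance and the accumulated error each contribute [1 / (r + 1) ^ 2] to the squared
   distance, and [2 <= 2 ^ 2]. *)
have near_q l : (l <= g n)%N -> mdist (u (n + l)%N) q <= 2 * r.+1%:R^-1.
  move=> lg.
  have desc_q i' : 2 * gamma i' * (F i'.+1 - F (nu j.+1)) <=
      mdist (u i') q ^+ 2 - mdist (u i'.+1) q ^+ 2 by rewrite /q nuq.
  have := descent_sum desc_q n l.
  have Fq0 : 0 <= F (nu j.+1) by rewrite nuq.
  have sum_ge : - (2 * l%:R * (L (n + g n - 1)%N)%:R * F (nu j.+1)) <=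
      \sum_(n <= i' < n + l) 2 * gamma i' * (F i'.+1 - F (nu j.+1)).
    rewrite (_ : - _ = \sum_(n <= i' < n + l)
        - (2 * (L (n + g n - 1)%N)%:R * F (nu j.+1))); last first.
      by rewrite sumr_const_nat addKn -mulr_natr; ring.
    apply: ler_sum_nat => i' /andP[ni' i'n].
    (* The last step size used has index at most [n + g n - 1], whence the argument of [L] in
       [chiM]. *)
    have gL : gamma i' <= (L (n + g n - 1)%N)%:R.
      apply: L_bound; rewrite leq_subRL ?add1n; last first.
        by rewrite (leq_trans _ (leq_trans i'n _))// leq_add2l.
      by rewrite (leq_trans i'n)// leq_add2l.
    have := ler_wpM2r Fq0 gL.
    have := mulr_ge0 (ltW (gamma0 i')) (F0 i'); lra.
  move=> /(le_trans sum_ge) dnl.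
  have {}dnl : mdist (u (n + l)%N) q ^+ 2 <= mdist (u n) q ^+ 2 +
      2 * l%:R * (L (n + g n - 1)%N)%:R * F (nu j.+1) by lra.
  have err : 2 * l%:R * (L (n + g n - 1)%N)%:R * F (nu j.+1) <= r.+1%:R^-1 ^+ 2.
    apply: le_trans (chiM_error R lg chi_ge).
    by rewrite ler_wpM2l// mulr_ge0// mulr_ge0.
  have dij' : mdist (u n) q <= r.+1%:R^-1 by [].
  rewrite -(ler_pXn2r (n := 2))// ?nnegrE ?mulr_ge0 ?mdist_ge0 ?invr_ge0//.
  rewrite (le_trans dnl)//.
  have : mdist (u n) q ^+ 2 <= r.+1%:R^-1 ^+ 2.
    by rewrite lerXn2r// nnegrE ?mdist_ge0 ?invr_ge0.
  move: err; set d := r.+1%:R^-1; rewrite exprMn; move: (_ * F _) => y.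
  by have := sqr_ge0 d; lra.
move=> s t /andP[ns sn] /andP[nt tn].
have := metric_triangle (u s) q (u t); rewrite (metric_sym q).
have := near_q (s - n)%N; rewrite leq_subLR subnKC// => /(_ sn).
have := near_q (t - n)%N; rewrite leq_subLR subnKC// => /(_ tn).
have -> : r.+1%:R^-1 = k.+1%:R^-1 / 4 :> R.
  by rewrite -invfM -natrM; congr (_%:R^-1); rewrite /r; lia.
move: (k.+1%:R^-1) => e. lra.
Qed.

(** * The proximal point algorithm *)

Theorem theorem4p1 (R : realType) (X : completeMetricType R)
    (alpha : nat -> nat) (f : X -> \bar R) (x : X) (b : R)
    (gamma : nat -> R) (theta L : nat -> nat)
    (X_CAT0 : CAT0 X)
    (X_tb : totally_bounded X)
    (alpha_mod : modulus_of_total_boundedness X alpha)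
    (f_proper : proper_function f)
    (f_convex : geodesically_convex f)
    (f_lsc : lower_semicontinuous f)
    (f_Argmin : Argmin f !=set0)
    (b_gt0 : 0 < b)
    (x_near_min : exists2 p, Argmin f p & mdist x p <= b)
    (gamma_gt0 : forall n, 0 < gamma n)
    (gamma_div : series gamma @ \oo --> +oo)
    (theta_rate : rate_of_divergence gamma theta)
    (L_nondecr : {homo L : m n / (m <= n)%N})
    (L_bound : forall k : nat,
       \big[Num.max/gamma 0%N]_(0 <= i < k.+1) gamma i <= (L k)%:R) :
  rate_of_metastability (proximal_point f gamma x) (Psi b theta L alpha) /\
  forall (k : nat) (g : nat -> nat),
    exists2 N, (N <= Omega b theta L alpha k g)%N &
      (forall i j : nat, (N <= i <= N + g N)%N -> (N <= j <= N + g N)%N ->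
         mdist (proximal_point f gamma x i) (proximal_point f gamma x j)
           <= k.+1%:R^-1) /\
      (forall m : nat, (N <= m)%N ->
         (f (proximal_point f gamma x m) <= min_value f + (k.+1%:R^-1)%:E)%E).
Proof.
have [p Ap xpb] := x_near_min.
have [m fp] : exists m, f p = m%:E.
  have [fNy [y0 fy0]] := f_proper; have := Ap y0; move: (fNy p) fy0.
  case: (f p) => [m| |]//=; first by exists m.
  by rewrite leye_eq => _ /negbTE ->.
have mf y : (m%:E <= f y)%E by rewrite -fp; exact: Ap.
set u := proximal_point f gamma x.
have stepP n :=
  resolventP (u n) X_CAT0 f_proper f_convex f_lsc mf (gamma_gt0 n).
(* Excess over the minimum. [fine] sends a possibly infinite [f x] to 0, so only the values at
   positive indices are meaningful. *)
pose F n := fine (f (u n)) - m.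
have fu n : f (u n.+1) = (F n.+1 + m)%:E.
  by have [s fs _] := stepP n; rewrite /F /= fs subrK.
have F_ge0 n : 0 <= F n.+1 by have := mf (u n.+1); rewrite fu lee_fin; lra.
have step n y r : f y = r%:E -> 2 * gamma n * (F n.+1 - (r - m)) <=
    mdist (u n) y ^+ 2 - mdist (u n.+1) y ^+ 2.
  move=> fy; have [s fs /(_ _ _ fy)] := stepP n.
  rewrite /F /= fs /=; have := sqr_ge0 (mdist (u n) (u n.+1)) => /=; lra.
have descF j n : 2 * gamma n * (F n.+1 - F j.+1) <=
    mdist (u n) (u j.+1) ^+ 2 - mdist (u n.+1) (u j.+1) ^+ 2.
  by have := step n _ _ (fu j); rewrite addrK.
have descp n : 2 * gamma n * F n.+1 <=
    mdist (u n) p ^+ 2 - mdist (u n.+1) p ^+ 2.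
  by have := step n _ _ fp; rewrite subrr subr0.
(* The descent inequality is tested at the current iterate itself. *)
have F_decr n : F n.+2 <= F n.+1.
  have := descF n n.+1; rewrite mdistxx expr0n /= sub0r => h.
  have : 2 * gamma n.+1 * (F n.+2 - F n.+1) <= 0.
    by rewrite (le_trans h)// oppr_le0 sqr_ge0.
  by rewrite pmulr_rle0 ?subr_le0// mulr_gt0.
have F_rate k n := @le_min_rate R X u gamma F b theta p b_gt0 gamma_gt0
  theta_rate F_decr descp xpb k n.
have gamma_le i k : (i <= k)%N -> gamma i <= (L k)%:R.
  move=> ik; rewrite (le_trans _ (L_bound k))// big_mkord.
  exact: (le_bigmax _ (fun i : 'I_k.+1 => gamma i)
    (Ordinal (ik : i < k.+1)%N)).
have metast a := @descent_metastability R X u gamma F b theta L a gamma_gt0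
  gamma_le F_ge0 descF F_rate.
split=> [|k g]; first exact: metast.
have [N N_le N_close] := metast _ (modulus_maj alpha_mod) k
  (shift_counter (min_rate b theta k) g).
set l := min_rate b theta k in N_le N_close *.
(* The shift by [l] puts all later indices in the range of [F_rate]; [shift_counter] widens the
   window at [N] enough to contain the window of [g] at [N + l]. *)
exists (N + l)%N; first by rewrite leq_add2r.
split=> [i j /andP[Ni iN] /andP[Nj jN]|n Nn].
  have window s : (s <= N + l + g (N + l))%N ->
      (s <= N + shift_counter l g N)%N.
    move=> /leq_trans; apply.
    by rewrite -addnA leq_add2l addnC leq_add2r leq_maj.
  by apply: N_close; rewrite window// (leq_trans (leq_addr l N)).
have ln : (l <= n)%N by rewrite (leq_trans _ Nn)// leq_addl.
have n0 : (0 < n)%N by rewrite (leq_trans _ ln)// /l /min_rate addn1.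
rewrite (min_valueE Ap) fp -(prednK n0) fu -EFinD lee_fin addrC lerD2l.
by rewrite prednK// F_rate.
Qed.
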